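(* Let $\chi(n)$ be the maximum, over all invertible $n\times n$ matrices $A$ with entries in $\{0,1\}$, of the largest absolute value of an entry of $A^{-1}$, and let $\rho_m$ be the maximum of $|\det B|$ over $m\times m$ matrices $B$ with entries in $\{0,1\}$. Then there is a function $g(n)=o(n)$ such that for all $n\ge2$ $$\frac{n^{n/2}}{2^{2n+g(n)}}\le\chi(n)\le\rho_{n-1}\le\frac{n^{n/2}}{2^{n-1}}.$$ *)

(* Defs.v *)
From HB Require Import structures.
From mathcomp Require Import all_boot all_order all_algebra.
From mathcomp Require Import all_classical all_reals all_analysis.
Set Implicit Arguments. Unset Strict Implicit. Unset Printing Implicit Defensive.
Import Order.TTheory GRing.Theory Num.Theory.
Local Open Scope ring_scope.

Definition mx01 (n m : nat) (A : 'M[bool]_(n, m)) : 'M[rat]_(n, m) :=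
  map_mx (fun b : bool => (b%:R : rat)) A.

Definition chi (n : nat) : rat :=
  \big[Num.max/0]_(A : 'M[bool]_n | mx01 A \in unitmx)
     \big[Num.max/0]_(i < n) \big[Num.max/0]_(j < n) `|invmx (mx01 A) i j|.

Definition rho (m : nat) : rat :=
  \big[Num.max/0]_(B : 'M[bool]_m) `|\det (mx01 B)|.

(* Main.v *)
Require Import Defs.
From HB Require Import structures.
From mathcomp Require Import all_boot all_order all_algebra.
From mathcomp Require Import all_classical all_reals all_analysis.
From mathcomp Require Import ring lra.
Import Order.TTheory GRing.Theory Num.Theory numFieldNormedType.Exports.
Local Open Scope classical_set_scope.
Local Open Scope ring_scope.

(** The upper bounds are classical: an entry of the inverse is a minor divided
    by a nonzero integer, and bordering a 0/1 matrix of order [n - 1] by ones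
    gives a sign matrix of order [n], to which Hadamard's inequality applies.

    For the lower bound let first [n = 2 ^ m], index rows and columns by bit
    vectors and write every row in the basis of characters (Walsh functions).
    Order the bit vectors as binary numbers. If [p < i] numerically, take the
    sign row that equals the character of [p] except on the subcube where all
    bits of [i], other than the highest bit [t] in which [i] and [p] differ,
    vanish, and equals the character of [i] there. Its expansion only involves
    vectors up to [i]; with [k] the weight of [i], the coefficient of [i] is
    [2 ^- (k - 1)] and that of [p] is [1 - 2 ^- (k - 1)]. Letting [p] be the
    predecessor of [i] among the vectors of weight at least 3 gives a matrix
    that is triangular in the basis of characters, and solving the triangular
    system multiplies the solution by about [2 ^ (k - 1)] at each step. The
    product of these factors is [n ^ (n / 2) / 2 ^ n] up to [2 ^ o(n)].

    For general [n], [chi] is supermultiplicative (couple two blocks by a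
    single 1), and splitting [n] along its binary expansion costs at most
    another factor [2 ^ n], by convexity of [x ln x]. *)

Set Implicit Arguments.
Unset Strict Implicit.
Unset Printing Implicit Defensive.

(** * Hadamard's inequality and the upper bounds *)

(** Symmetry is part of the notion, so that the lower left block of a bordered matrix can be read
    off as [b^T]. *)
Definition posdefmx (F : realFieldType) (n : nat) (G : 'M[F]_n) : Prop :=
  G^T = G /\ forall v : 'rV_n, v != 0 -> 0 < (v *m G *m v^T) 0 0.

Lemma posdefmx_diag (F : realFieldType) (n : nat) (G : 'M[F]_n) (i : 'I_n) :
  posdefmx G -> 0 < G i i.
Proof.
case=> _ /(_ (delta_mx 0 i)).
pose e : 'rV[F]_n := delta_mx 0 i; rewrite -/e.
have -> : (e *m G *m e^T) 0 0 = G i i.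
  by rewrite /e -rowE trmx_delta -colE !mxE.
apply; apply/eqP => /matrixP /(_ 0 i) /eqP.
by rewrite !mxE !eqxx oner_eq0.
Qed.

(** For fixed [v], the first coordinate of [u] is the one that minimises the quadratic form; the
    minimum is the value of the Schur complement at [v]. *)
Lemma posdefmx_schur (F : realFieldType) (n : nat) (a : 'M[F]_1) (b : 'rV[F]_n)
    (C : 'M[F]_n) :
  posdefmx (block_mx a b b^T C) ->
  0 < a 0 0 /\ posdefmx (C - (a 0 0)^-1 *: (b^T *m b)).
Proof.
move=> PG; have a_gt0 : 0 < a 0 0.
  by have := posdefmx_diag (lshift n 0) PG; rewrite block_mxEul.
case: PG => symG posG; split=> //; split.
  have [_ _ _ symC] := eq_block_mx (etrans (esym (tr_block_mx a b b^T C)) symG).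
  by rewrite linearB linearZ /= trmx_mul trmxK symC.
move=> v v_neq0.
pose u : 'rV[F]_(1 + n) := row_mx (- (a 0 0)^-1 *: (v *m b^T)) v.
have u_neq0 : u != 0.
  by apply: contraNneq v_neq0 => /eqP; rewrite /u row_mx_eq0 => /andP[].
have := posG _ u_neq0.
rewrite /u mul_row_block tr_row_mx mul_row_col.
have -> : - (a 0 0)^-1 *: (v *m b^T) *m a + v *m b^T = 0.
  rewrite [a in _ *m a]mx11_scalar mul_mx_scalar scalerA mulrN mulfV ?gt_eqF//.
  by rewrite scaleN1r addNr.
rewrite mul0mx add0r -scalemxAl mulmxBr -scalemxAr mulmxA scaleNr addrC.
by [].
Qed.

Lemma det_schur_complement (F : realFieldType) (n : nat) (a : 'M[F]_1)
    (b : 'rV[F]_n) (C : 'M[F]_n) : a 0 0 != 0 ->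
  \det (block_mx a b b^T C) = a 0 0 * \det (C - (a 0 0)^-1 *: (b^T *m b)).
Proof.
move=> a_neq0.
have -> : block_mx a b b^T C =
    block_mx 1%:M 0 ((a 0 0)^-1 *: b^T) 1%:M
    *m block_mx a b 0 (C - (a 0 0)^-1 *: (b^T *m b)).
  rewrite mulmx_block !mul1mx !mul0mx !addr0 ?mulmx0 ?addr0; congr block_mx.
    by rewrite [a in _ *m a]mx11_scalar mul_mx_scalar scalerA mulfV// scale1r.
  by rewrite -scalemxAl addrC subrK.
by rewrite det_mulmx det_lblock det_ublock !det1 !mul1r [a in \det a]mx11_scalar det_scalar1.
Qed.

(** Induction on the order: passing to the Schur complement subtracts [b_i ^ 2 / a] from each
    remaining diagonal entry, hence can only decrease it. *)
Lemma hadamard_posdefmx (F : realFieldType) (n : nat) (G : 'M[F]_n) :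
  posdefmx G -> 0 < \det G <= \prod_i G i i.
Proof.
elim: n G => [|n IHn] G; first by rewrite det_mx00 big_ord0 ltr01 lexx.
rewrite -[n.+1]/(1 + n)%N in G *; rewrite -(submxK G).
set a := ulsubmx G; set b := ursubmx G; set C := drsubmx G; move=> PG.
have bT : dlsubmx G = b^T.
  by case: PG => + _; rewrite tr_block_mx => /eq_block_mx [_ _ <- _].
rewrite bT in PG |- *.
have [a_gt0 PS] := posdefmx_schur PG; have /andP[S_gt0 S_le] := IHn _ PS.
rewrite det_schur_complement ?gt_eqF// mulr_gt0//= big_split_ord big_ord1.
rewrite block_mxEul; apply: ler_wpM2l (ltW a_gt0) _ _ _.
apply: le_trans S_le _.
apply: ler_prod => i _; rewrite block_mxEdr ltW ?posdefmx_diag//=.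
rewrite !mxE big_ord1 !mxE gerBl -expr2; apply: mulr_ge0; last exact: sqr_ge0.
by move: (ltW a_gt0); rewrite invr_ge0 !mxE.
Qed.

(** The Gram matrix [M *m M^T] has determinant [\det M ^+ 2] and the squared row norms on its
    diagonal; it is positive definite unless [M] is singular. *)
Lemma hadamard_ineq (F : realFieldType) (n : nat) (M : 'M[F]_n) :
  (\det M) ^+ 2 <= \prod_i \sum_j (M i j) ^+ 2.
Proof.
have diagE i : (M *m M^T) i i = \sum_j (M i j) ^+ 2.
  by rewrite mxE; apply: eq_bigr => j _; rewrite mxE expr2.
have [->|detM] := eqVneq (\det M) 0.
  by rewrite expr0n prodr_ge0// => i _; rewrite sumr_ge0// => j _; exact: sqr_ge0.
under eq_bigr do rewrite -diagE.
have -> : (\det M) ^+ 2 = \det (M *m M^T) by rewrite det_mulmx det_tr expr2.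
suff /hadamard_posdefmx /andP[] : posdefmx (M *m M^T) by [].
split; first by rewrite trmx_mul trmxK.
move=> v v_neq0; have vM_neq0 : v *m M != 0.
  apply: contraNneq v_neq0 => vM0.
  have uM : M \in unitmx by rewrite unitmxE unitfE.
  by rewrite -(mulmxK uM v) vM0 mul0mx.
rewrite mulmxA -mulmxA -trmx_mul mxE lt_neqAle.
have sq_ge0 j : true -> 0 <= (v *m M) 0 j * (v *m M)^T j 0.
  by rewrite [_^T _ _]mxE -expr2 sqr_ge0.
rewrite sumr_ge0// andbT eq_sym psumr_eq0//.
apply: contra vM_neq0 => /allP vM0; apply/eqP/rowP => j.
have := vM0 j (mem_index_enum _).
by rewrite [_^T _ _]mxE mulf_eq0 orbb [in RHS]mxE => /eqP.
Qed.

(** * Entries of the inverse, minors and sign matrices *)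

Lemma det_mx01_ge1 (n : nat) (A : 'M[bool]_n) :
  mx01 A \in unitmx -> 1 <= `|\det (mx01 A)|.
Proof.
have -> : mx01 A = map_mx intr (map_mx (fun b : bool => (b%:R : int)) A).
  by apply/matrixP => i j; rewrite !mxE; case: (A i j).
by rewrite unitmxE unitfE det_map_mx intr_eq0 -intr_norm ler1z => ?; rewrite -gtz0_ge1 normr_gt0.
Qed.

Lemma rho_ge0 (m : nat) : 0 <= rho m.
Proof. exact: bigmax_ge_id. Qed.

Lemma rho_ge (m : nat) (B : 'M[bool]_m) : `|\det (mx01 B)| <= rho m.
Proof. exact: le_bigmax. Qed.

Lemma chi_ge (n : nat) (A : 'M[bool]_n) (i j : 'I_n) :
  mx01 A \in unitmx -> `|invmx (mx01 A) i j| <= chi n.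
Proof.
move=> uA; apply: (bigmax_sup A) => //.
by apply: (bigmax_sup i) => //; apply: (bigmax_sup j).
Qed.

Lemma chi_le_rho (n : nat) : chi n <= rho n.-1.
Proof.
apply/bigmax_leP; split=> [|A uA]; first exact: rho_ge0.
apply/bigmax_leP; split=> [|i _]; first exact: rho_ge0.
apply/bigmax_leP; split=> [|j _]; first exact: rho_ge0.
rewrite /invmx uA !mxE normrM normfV.
have cofE : `|cofactor (mx01 A) j i| = `|\det (mx01 (row' j (col' i A)))|.
  rewrite /cofactor normrM normrX normrN1 expr1n mul1r; congr (`|\det _|).
  by apply/matrixP => k l; rewrite !mxE.
rewrite cofE; apply: le_trans (rho_ge (row' j (col' i A))).
have d1 := det_mx01_ge1 uA; rewrite ler_piMl ?normr_ge0// invf_le1//.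
exact: lt_le_trans d1.
Qed.

(* Bordering by ones turns the 0/1 matrix [B] into a +-1 matrix of order one more. *)
Lemma det_border_sign (m : nat) (B : 'M[rat]_m) :
  \det (block_mx (1%:M : 'M[rat]_1) (const_mx 1) (const_mx 1) (const_mx 1 - 2%:R *: B))
  = (- 2) ^+ m * \det B.
Proof.
have -> : block_mx (1%:M : 'M[rat]_1) (const_mx 1) (const_mx 1) (const_mx 1 - 2%:R *: B) =
    block_mx 1%:M 0 (const_mx 1) 1%:M *m block_mx 1%:M (const_mx 1) 0 (- 2%:R *: B).
  rewrite mulmx_block !mul1mx !mul0mx !mulmx1 ?mulmx0 !addr0; congr block_mx.
  by apply/matrixP => i j; rewrite !mxE big_ord1 !mxE mulr1 mulNr.
by rewrite det_mulmx det_lblock det_ublock !det1 !mul1r detZ.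
Qed.

(** Squaring keeps the bound rational; the half-integer power only appears over the reals. Every row
    of the bordered sign matrix has squared norm [m.+1]. *)
Lemma rho_sqr_le (m : nat) : (2 ^+ m * rho m) ^+ 2 <= m.+1%:R ^+ m.+1.
Proof.
suff [] : 0 <= rho m /\ (2 ^+ m * rho m) ^+ 2 <= m.+1%:R ^+ m.+1 by [].
pose small (r : rat) := 0 <= r /\ (2 ^+ m * r) ^+ 2 <= m.+1%:R ^+ m.+1.
rewrite -/(small _); apply: (big_ind small) => [|r s|B _].
- by split=> //; rewrite mulr0 expr0n exprn_ge0.
- by move=> ? ?; rewrite maxEle; case: ifP.
split=> //; rewrite exprMn real_normK ?num_real//.
have <- : ((- 2) ^+ m * \det (mx01 B)) ^+ 2 = (2 ^+ m) ^+ 2 * \det (mx01 B) ^+ 2.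
  by rewrite exprMn -!exprM mulnC !exprM sqrrN.
rewrite -det_border_sign; apply: le_trans (hadamard_ineq _) _.
set S := block_mx _ _ _ _.
have S2 i j : S i j ^+ 2 = 1.
  rewrite -[i]splitK -[j]splitK /S; case: (fintype.split i) => i'; case: (fintype.split j) => j'.
  - by rewrite block_mxEul !ord1 mxE expr1n.
  - by rewrite block_mxEur mxE expr1n.
  - by rewrite block_mxEdl mxE expr1n.
  by rewrite block_mxEdr !mxE; case: (B i' j'); rewrite ?mulr0 ?mulr1 ?subr0 ?expr1n// opprD addNKr sqrrN expr1n.
under eq_bigr do under eq_bigr do rewrite S2.
by rewrite sumr_const prodr_const card_ord.
Qed.

(** * Supermultiplicativity of [chi] *)

Lemma mulmx1_invmx (F : fieldType) (n : nat) (A B : 'M[F]_n) :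
  A *m B = 1%:M -> A \in unitmx /\ invmx A = B.
Proof.
move=> AB1; have [uA _] := mulmx1_unit AB1.
by split=> //; rewrite -[LHS]mulmx1 -AB1 mulKmx.
Qed.

Lemma mx01_scalar1 (n : nat) : mx01 (\matrix_(i, j) (i == j) : 'M[bool]_n) = 1%:M.
Proof. by apply/matrixP => i j; rewrite !mxE. Qed.

Lemma chi_attained (n : nat) : (0 < n)%N ->
  exists (A : 'M[bool]_n) (i j : 'I_n),
    mx01 A \in unitmx /\ chi n = `|invmx (mx01 A) i j|.
Proof.
move=> n_gt0; pose i0 := Ordinal n_gt0.
have u1 : mx01 (\matrix_(i, j) (i == j) : 'M[bool]_n) \in unitmx.
  by rewrite mx01_scalar1 unitmx1.
rewrite /chi; have [|A uA ->] := @eq_bigmax _ _ _ 0 _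
    (fun A : 'M[bool]_n => mx01 A \in unitmx)
    (fun A => \big[Num.max/0]_(i < n) \big[Num.max/0]_(j < n) `|invmx (mx01 A) i j|) u1.
  move=> A _.
  exact: bigmax_ge_id.
rewrite /in_mem /= in uA.
have [//||i _ ->] := @eq_bigmax _ _ _ 0 i0 predT
    (fun i => \big[Num.max/0]_(j < n) `|invmx (mx01 A) i j|).
  by move=> i _; exact: bigmax_ge_id.
have [//|//|j _ ->] := @eq_bigmax _ _ _ 0 i0 predT (fun j => `|invmx (mx01 A) i j|).
by exists A, i, j.
Qed.

Lemma chi_ge1 (n : nat) : (0 < n)%N -> 1 <= chi n.
Proof.
move=> n_gt0; pose i0 := Ordinal n_gt0.
have := @chi_ge n (\matrix_(i, j) (i == j)) i0 i0.
by rewrite mx01_scalar1 unitmx1 invmx1 !mxE eqxx normr1; apply.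
Qed.

(* The two blocks are coupled by a single 1, so the off-diagonal block of the
   inverse is a rank one matrix containing the product of the extremal entries. *)
Lemma chi_mul_le (n1 n2 : nat) : (0 < n1)%N -> (0 < n2)%N ->
  chi n1 * chi n2 <= chi (n1 + n2).
Proof.
move=> /chi_attained[A [q [l [uA ->]]]] /chi_attained[B [i [p [uB ->]]]].
pose E : 'M[bool]_(n2, n1) := \matrix_(a, b) ((a == p) && (b == q)).
pose M := block_mx A (const_mx false) E B.
pose N := block_mx (invmx (mx01 A)) 0
  (- (invmx (mx01 B) *m mx01 E *m invmx (mx01 A))) (invmx (mx01 B)).
have EE : mx01 E = delta_mx p q by apply/matrixP => a b; rewrite !mxE.
have ME : mx01 M = block_mx (mx01 A) 0 (mx01 E) (mx01 B).
  rewrite /mx01 /M map_block_mx; congr block_mx.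
  by apply/matrixP => a b; rewrite !mxE.
have MN : mx01 M *m N = 1%:M.
  rewrite ME mulmx_block !mul0mx !mulmx0 !addr0 add0r mulmxN !mulmxA.
  by rewrite !mulmxV// mul1mx subrr -scalar_mx_block.
have [uM NE] := mulmx1_invmx MN.
have := chi_ge (rshift n1 i) (lshift n2 l) uM.
rewrite NE block_mxEdl mxE normrN EE mulrC -normrM.
suff -> : (invmx (mx01 B) *m delta_mx p q *m invmx (mx01 A)) i l =
  invmx (mx01 B) i p * invmx (mx01 A) q l by [].
rewrite -mulmxA mxE (bigD1 p)//= big1 ?addr0 => [|a /negPf ap].
  congr (_ * _); rewrite mxE (bigD1 q)//= big1 ?addr0 => [|b /negPf bq].
    by rewrite mxE !eqxx mul1r.
  by rewrite mxE bq andbF mul0r.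
by rewrite mxE [X in _ * X]big1 ?mulr0// => b _; rewrite mxE ap mul0r.
Qed.

(** * Walsh functions and flipped characters *)

Definition bitv (m : nat) := {ffun 'I_m -> bool}.

Definition bitv_xor (m : nat) (a b : bitv m) : bitv m := [ffun t => a t (+) b t].

Definition bitv_sub (m : nat) (a b : bitv m) : bool := [forall t, a t ==> b t].

Definition popcount (m : nat) (a : bitv m) : nat := (\sum_t a t)%N.

Definition bitv_rank (m : nat) (a : bitv m) : nat := (\sum_(t < m) a t * 2 ^ t)%N.

Definition walsh (m : nat) (a x : bitv m) : rat := \prod_t (-1) ^+ (a t && x t).

Lemma bitv_xorK (m : nat) (a : bitv m) : involutive (fun b => bitv_xor b a).
Proof. by move=> b; apply/ffunP => t; rewrite !ffunE addbK. Qed.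

Lemma walshC (m : nat) (a x : bitv m) : walsh a x = walsh x a.
Proof. by apply: eq_bigr => t _; rewrite andbC. Qed.

Lemma walsh0 (m : nat) (x : bitv m) : walsh [ffun=> false] x = 1.
Proof. by rewrite /walsh big1// => t _; rewrite ffunE. Qed.

Lemma walsh_xor (m : nat) (a b x : bitv m) :
  walsh (bitv_xor a b) x = walsh a x * walsh b x.
Proof.
rewrite /walsh -big_split /=; apply: eq_bigr => t _.
by rewrite ffunE andb_addl signr_addb.
Qed.

Lemma walsh_sign (m : nat) (a x : bitv m) : (walsh a x == 1) || (walsh a x == -1).
Proof.
apply: (big_ind (fun r : rat => (r == 1) || (r == -1))) => //.
  by move=> r s /orP[] /eqP -> /orP[] /eqP ->; rewrite ?mulr1 ?mul1r ?mulN1r ?opprK eqxx ?orbT.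
by move=> t _; case: (_ && _); rewrite ?eqxx ?orbT.
Qed.

Lemma norm_walsh (m : nat) (a x : bitv m) : `|walsh a x| = 1.
Proof. by case/orP: (walsh_sign a x) => /eqP ->; rewrite ?normrN normr1. Qed.

(** The sum factors over the coordinates: a coordinate in [K] contributes [1 + (-1) ^ (x t)], which
    is 2 or 0, and any other one contributes 1. *)
Lemma sum_walsh_sub (m : nat) (K x : bitv m) :
  \sum_(a | bitv_sub a K) walsh a x
  = [forall t, ~~ (K t && x t)]%:R * 2 ^+ popcount K.
Proof.
transitivity (\sum_(a in family (fun t => [pred b | b ==> K t])) walsh a x).
  by apply: eq_bigl => a; apply/forallP/familyP.
rewrite -(bigA_distr_big_dep _ (fun t b => (-1) ^+ (b && x t))).
have E t : \sum_(b | b ==> K t) (-1) ^+ (b && x t)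
    = (~~ (K t && x t))%:R * 2 ^+ K t :> rat.
  rewrite big_mkcond big_bool.
  by case: (K t); case: (x t); rewrite /= ?addr0 ?add0r ?addNr ?mul0r ?mul1r ?expr0 ?expr1.
under eq_bigr do rewrite E.
rewrite big_split /= -expr_sum; congr (_ * _).
case: (boolP [forall t, _]) => [/forallP H|].
  by rewrite big1// => t _; rewrite H.
rewrite negb_forall => /existsP[t /negPf Ht].
by rewrite (bigD1 t)//= Ht mul0r.
Qed.

Lemma sum_walsh_coset (m : nat) (K p x : bitv m) :
  \sum_(a | bitv_sub (bitv_xor a p) K) walsh a x
  = [forall t, ~~ (K t && x t)]%:R * 2 ^+ popcount K * walsh p x.
Proof.
rewrite -sum_walsh_sub mulr_suml.
rewrite (reindex_inj (inv_inj (@bitv_xorK m p))) /=.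
by apply: eq_big => a; rewrite ?bitv_xorK// walsh_xor.
Qed.

Lemma walsh_orthogonal (m : nat) (x y : bitv m) :
  \sum_a walsh a x * walsh a y = (x == y)%:R * 2 ^+ m.
Proof.
transitivity (\sum_(a | bitv_sub a [ffun=> true]) walsh a (bitv_xor x y)).
  apply: eq_big => [a|a _]; last by rewrite ![walsh a _]walshC walsh_xor.
  by apply/esym/forallP => t; rewrite ffunE implybT.
rewrite sum_walsh_sub; congr (_%:R * _ ^+ _); last first.
  rewrite /popcount (eq_bigr (fun=> 1%N)) => [|t _]; last by rewrite ffunE.
  by rewrite sum1_card card_ord.
congr nat_of_bool; apply/forallP/eqP => [H|-> t]; last by rewrite !ffunE addbb andbF.
by apply/ffunP => t; have := H t; rewrite !ffunE /= negb_add => /eqP.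
Qed.

(** * The numerical order of bit vectors *)

Lemma sum_pow2_lt (m t : nat) : (t <= m)%N -> (\sum_(s < m | s < t) 2 ^ s < 2 ^ t)%N.
Proof.
move=> tm; rewrite -(big_ord_widen m (fun s => 2 ^ s)%N tm).
elim: t {tm} => [|t IH]; first by rewrite big_ord0.
by rewrite big_ord_recr /= expnS mul2n -addnn ltn_add2r.
Qed.

(** The bits of [a] below [t] add up to less than [2 ^ t]. Above [t] an implication is assumed
    instead of equality, because elements of a coset of [p] may lose bits of [i] there. *)
Lemma bitv_rank_lt (m : nat) (a b : bitv m) (t : 'I_m) :
  (forall s : 'I_m, (t < s)%N -> a s ==> b s) -> ~~ a t -> b t ->
  (bitv_rank a < bitv_rank b)%N.
Proof.
move=> ab /negPf at0 bt1.
have rankE (c : bitv m) : bitv_rank c = (\sum_(s < m | (s < t)%N) c s * 2 ^ s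
    + (c t * 2 ^ t + \sum_(s < m | (t < s)%N) c s * 2 ^ s))%N.
  rewrite /bitv_rank (bigID (fun s : 'I_m => (s < t)%N)) /=; congr addn.
  rewrite (bigD1 t) ?ltnn//=; congr addn; apply: eq_bigl => s.
  by rewrite -leqNgt ltn_neqAle andbC eq_sym.
rewrite !rankE at0 bt1 mul0n mul1n add0n -addSn.
apply: leq_trans (leq_addl _ _); apply: leq_add.
  apply: leq_ltn_trans (sum_pow2_lt (ltnW (ltn_ord t))).
  by apply: leq_sum => s _; case: (a s); rewrite ?mul1n.
by apply: leq_sum => s /ab; case: (a s) => //= ->.
Qed.

Lemma bitv_top_diff (m : nat) (a b : bitv m) : a != b ->
  exists2 t : 'I_m, (forall s : 'I_m, (t < s)%N -> a s = b s) & a t != b t.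
Proof.
move=> ab; have /existsP[t0 Ht0] : [exists t, a t != b t].
  rewrite -negb_forall; apply: contra ab => /forallP H.
  by apply/eqP/ffunP => t; apply/eqP.
have [t Ht tmax] := @arg_maxnP _ t0 (fun t => a t != b t) (fun t : 'I_m => t : nat) Ht0.
exists t => // s ts; apply/eqP; apply: contraTT ts => Hs.
by rewrite -leqNgt; apply: tmax.
Qed.

Lemma bitv_rank_ltP (m : nat) (a b : bitv m) : (bitv_rank a < bitv_rank b)%N ->
  exists t : 'I_m, [/\ forall s : 'I_m, (t < s)%N -> a s = b s, ~~ a t & b t].
Proof.
move=> ltab; have /bitv_top_diff[t eq_ab neq_ab] : a != b.
  by apply: contraTneq ltab => ->; rewrite ltnn.
exists t; suff : ~~ a t by move: neq_ab; case: (a t) (b t) => [] [].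
apply/negP => at1; have bt0 : ~~ b t by move: neq_ab at1; case: (a t) (b t) => [] [].
suff : (bitv_rank b < bitv_rank a)%N by rewrite ltnNge ltnW.
by apply: (bitv_rank_lt (t := t)) => // s /eq_ab ->; apply/implyP.
Qed.

Lemma bitv_rank_inj (m : nat) : injective (@bitv_rank m).
Proof.
move=> a b eq_ab; apply/eqP/contraT => /bitv_top_diff[t eq_s neq_t].
have H (c d : bitv m) : bitv_rank c = bitv_rank d ->
    (forall s : 'I_m, (t < s)%N -> c s = d s) -> ~~ c t -> d t -> false.
  move=> eq_cd E ct dt; suff : (bitv_rank c < bitv_rank d)%N by rewrite eq_cd ltnn.
  by apply: (bitv_rank_lt (t := t)) => // s /E ->; apply/implyP.
case: (boolP (a t)) neq_t => [at1 bt|at0].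
  by apply: (H b a) => // s /eq_s.
by rewrite eq_sym; case: (boolP (b t)) => // bt _; apply: (H a b).
Qed.

(* The row: it agrees with the character of [p], except on a subcube of
   codimension [popcount i - 1], where it agrees with the character of [i]. *)
Lemma flipped_character (m : nat) (p i : bitv m) :
  (bitv_rank p < bitv_rank i)%N ->
  exists (f : bitv m -> bool) (c : bitv m -> rat),
    (forall j, `|c j| <= 1) /\
    forall x, 2 ^+ (popcount i).-1 * (2 * (f x)%:R - 1)
      = (2 ^+ (popcount i).-1 - 1) * walsh p x + walsh i x
        + \sum_(j | (bitv_rank j < bitv_rank i)%N && (j != p)) c j * walsh j x.
Proof.
move=> /bitv_rank_ltP[t [eq_pi pt it]].
pose K : bitv m := [ffun s => i s && (s != t)].
have popK : popcount K = (popcount i).-1.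
  rewrite /popcount (bigD1 t)//= [in RHS](bigD1 t)//= it add1n /= ffunE eqxx andbF add0n.
  by apply: eq_bigr => s st; rewrite ffunE st andbT.
(* Up to the factor [2 ^- popcount K], the indicator of the subcube [C] is the sum of the characters
   supported in [K]. Multiplying it by the difference of the characters of [i] and [p] turns this
   into a difference of two coset sums, with coefficients [c]. *)
pose c j : rat := (bitv_sub (bitv_xor j i) K)%:R - (bitv_sub (bitv_xor j p) K)%:R.
pose C (x : bitv m) := [forall s, ~~ (K s && x s)].
pose f x := walsh (if C x then i else p) x == 1.
have f_sign x : 2 * (f x)%:R - 1 = walsh (if C x then i else p) x.
  rewrite /f; case/orP: (walsh_sign (if C x then i else p) x) => /eqP ->.
    by rewrite eqxx mulr1 addrK.
  by rewrite mulr0 sub0r.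
have sum_c x : \sum_j c j * walsh j x
    = (C x)%:R * 2 ^+ (popcount i).-1 * (walsh i x - walsh p x).
  rewrite -popK mulrBr -!sum_walsh_coset [in RHS]big_mkcond [X in _ = _ - X]big_mkcond /=.
  rewrite -sumrB; apply: eq_bigr => j _; rewrite /c mulrBl.
  by do 2!case: (bitv_sub _ _); rewrite ?mul0r ?mul1r.
have i_neq_p : i != p by apply: contraTneq it => ->.
have subxx j : bitv_sub (bitv_xor j j) K by apply/forallP => s; rewrite ffunE addbb.
(* The cosets of [i] and [p] are disjoint, since these vectors differ at [t], which lies outside
   [K]. *)
have cp : c p = -1.
  rewrite /c subxx; suff /negPf -> : ~~ bitv_sub (bitv_xor p i) K by rewrite sub0r.
  by apply/forallPn; exists t; rewrite !ffunE eqxx andbF (negPf pt) it.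
have ci : c i = 1.
  rewrite /c subxx; suff /negPf -> : ~~ bitv_sub (bitv_xor i p) K by rewrite subr0.
  by apply/forallPn; exists t; rewrite !ffunE eqxx andbF (negPf pt) it.
(* Elements of the coset of [i] are contained in [i]; those of the coset of [p] vanish at [t] and
   are contained in [i] above [t]. Neither can exceed [i] numerically. *)
have c0 j : j != i -> ~~ (bitv_rank j < bitv_rank i)%N -> c j = 0.
  move=> ji; rewrite /c; case: (boolP (bitv_sub (bitv_xor j i) K)) => [/forallP jiK|_].
    move=> /negP[]; have [u eq_u neq_u] := bitv_top_diff ji.
    have := jiK u; rewrite !ffunE => jiKu.
    apply: (bitv_rank_lt (t := u)) => [s /eq_u ->||]; first exact/implyP.
      by move: neq_u jiKu; case: (j u) (i u) => [] [].
    by move: neq_u jiKu; case: (j u) (i u) => [] [].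
  case: (boolP (bitv_sub (bitv_xor j p) K)) => [/forallP jpK|_]; last by rewrite subrr.
  move=> /negP[]; apply: (bitv_rank_lt (t := t)) => // [s ts|].
    have := jpK s; rewrite !ffunE (eq_pi s ts).
    by case: (j s) (i s) => [] [].
  by have := jpK t; rewrite !ffunE eqxx andbF (negPf pt) addbF implybF.
exists f, c; split=> [j|x].
  by rewrite /c; do 2!case: (bitv_sub _ _).
rewrite f_sign.
have -> : \sum_(j | (bitv_rank j < bitv_rank i)%N && (j != p)) c j * walsh j x
    = \sum_j c j * walsh j x + walsh p x - walsh i x.
  rewrite [in RHS](bigD1 p)//= [in RHS](bigD1 i)//= cp ci mulN1r mul1r.
  rewrite big_mkcond [in RHS]big_mkcond /=.
  rewrite [RHS](_ : _ = \sum_j if (j != p) && (j != i) then c j * walsh j x else 0); last by ring.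
  apply: eq_bigr => j _; case: (eqVneq j p) => _; first by rewrite andbF.
  rewrite andbT; case: (eqVneq j i) => [->|ji]; first by rewrite ltnn.
  by case: ifPn => // /(c0 _ ji) ->; rewrite mul0r.
by rewrite sum_c; case: (C x) => /=; ring.
Qed.

(** * The triangular system *)

(* Only the vectors of weight at least 3 take part in the growth chain: for
   smaller weights the factor [2 ^ (weight - 1) - 2] is useless. *)
Definition heavy (m : nat) (i : bitv m) : bool := (2 < popcount i)%N.

(** These are all heavy vectors except the numerically least one, where the chain starts. *)
Definition chained (m : nat) (i : bitv m) : bool :=
  heavy i && [exists j : bitv m, heavy j && (bitv_rank j < bitv_rank i)%N].

Definition chain_pred (m : nat) (i p : bitv m) : Prop :=
  [/\ heavy p, (bitv_rank p < bitv_rank i)%N &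
      forall j : bitv m, heavy j -> (bitv_rank j < bitv_rank i)%N ->
        (bitv_rank j <= bitv_rank p)%N].

Definition chain_row (m : nat) (i : bitv m) (f : bitv m -> bool) : Prop :=
  if chained i then
    exists (p : bitv m) (c : bitv m -> rat), [/\ chain_pred i p, forall j, `|c j| <= 1 &
      forall x, 2 ^+ (popcount i).-1 * (2 * (f x)%:R - 1)
        = (2 ^+ (popcount i).-1 - 1) * walsh p x + walsh i x
          + \sum_(j : bitv m | (bitv_rank j < bitv_rank i)%N && (j != p)) c j * walsh j x]
  else forall x, 2 * (f x)%:R - 1 = walsh i x.

Lemma chain_predP (m : nat) (i : bitv m) : chained i -> exists p, chain_pred i p.
Proof.
case/andP=> _ /existsP[j0 Hj0].
have [p /andP[hp pi] pmax] := @arg_maxnP _ j0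
  (fun j : bitv m => heavy j && (bitv_rank j < bitv_rank i)%N) (@bitv_rank m) Hj0.
by exists p; split=> // j hj ji; apply: pmax; rewrite hj.
Qed.

Lemma chain_row_exists (m : nat) (i : bitv m) : exists f, chain_row i f.
Proof.
rewrite /chain_row; case: (boolP (chained i)) => [/chain_predP[p Hp]|_].
  have [_ pi _] := Hp; have [f [c [c1 fE]]] := flipped_character pi.
  by exists f, p, c.
exists (fun x => walsh i x == 1) => x.
case/orP: (walsh_sign i x) => /eqP ->; first by rewrite eqxx mulr1 addrK.
by rewrite mulr0 sub0r.
Qed.

Definition walsh_transform (m : nat) (y : bitv m -> rat) (a : bitv m) : rat :=
  \sum_x y x * walsh a x.

Lemma walsh_transform_eq0 (m : nat) (y : bitv m -> rat) :
  walsh_transform y =1 (fun=> 0) -> y =1 (fun=> 0).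
Proof.
move=> X0 x; apply: (mulfI (x := 2 ^+ m)); first by rewrite expf_neq0.
rewrite mulr0; transitivity (\sum_a walsh_transform y a * walsh a x); last first.
  by rewrite big1// => a _; rewrite X0 mul0r.
under eq_bigr do rewrite /walsh_transform mulr_suml.
rewrite exchange_big /= (bigD1 x)//= [X in _ = _ + X]big1 ?addr0 => [|z /negPf zx].
  under eq_bigr do rewrite -mulrA.
  by rewrite -mulr_sumr walsh_orthogonal eqxx mul1r mulrC.
under eq_bigr do rewrite -mulrA.
by rewrite -mulr_sumr walsh_orthogonal zx mul0r mulr0.
Qed.

(** The character of the zero vector is constant 1, so replacing the 0/1 row by its sign row
    subtracts [X [ffun=> false]]. What results is the equation of row [i] in a triangular system for
    [X]. *)
Lemma chain_row_pairing (m : nat) (i : bitv m) (f : bitv m -> bool) (y : bitv m -> rat)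
    (X := walsh_transform y) : chain_row i f ->
  if chained i then
    exists (p : bitv m) (c : bitv m -> rat), [/\ chain_pred i p, forall j, `|c j| <= 1 &
      2 ^+ (popcount i).-1 * (2 * (\sum_x y x * (f x)%:R) - X [ffun=> false])
        = (2 ^+ (popcount i).-1 - 1) * X p + X i
          + \sum_(j : bitv m | (bitv_rank j < bitv_rank i)%N && (j != p)) c j * X j]
  else 2 * (\sum_x y x * (f x)%:R) - X [ffun=> false] = X i.
Proof.
have pairE : 2 * (\sum_x y x * (f x)%:R) - X [ffun=> false]
    = \sum_x y x * (2 * (f x)%:R - 1).
  rewrite mulr_sumr -sumrB; apply: eq_bigr => x _; by rewrite walsh0; ring.
rewrite /chain_row; case: ifP => _; [case=> p [c [Hp c1 fE]]|move=> fE]; last first.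
  by rewrite pairE; apply: eq_bigr => x _; rewrite fE.
exists p, c; split=> //; rewrite pairE mulr_sumr.
under eq_bigr do rewrite mulrCA fE !mulrDr.
rewrite !big_split /= mulr_sumr; congr (_ + _ + _).
  by apply: eq_bigr => x _; rewrite mulrCA.
rewrite [RHS](eq_bigr _ (fun j _ => mulr_sumr _ _ _ _)) exchange_big /=.
apply: eq_bigr => x _; rewrite mulr_sumr; apply: eq_bigr => j _; by ring.
Qed.

Lemma popcount0 (m : nat) : popcount ([ffun=> false] : bitv m) = 0%N.
Proof. by rewrite /popcount big1// => t _; rewrite ffunE. Qed.

Lemma light_not_chained (m : nat) (i : bitv m) : ~~ heavy i -> chained i = false.
Proof. by rewrite /chained => /negPf ->. Qed.

Lemma chain_transform0 (m : nat) (f : bitv m -> bitv m -> bool) (y : bitv m -> rat) :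
  (forall i, chain_row i (f i)) -> \sum_x y x * (f [ffun=> false] x)%:R = 0 ->
  walsh_transform y [ffun=> false] = 0.
Proof.
move=> /(_ [ffun=> false]) /(chain_row_pairing y).
rewrite light_not_chained => [+ S0|]; last by rewrite /heavy popcount0.
by rewrite S0 mulr0 sub0r => /eqP; rewrite eq_sym -subr_eq0 opprK -mulr2n mulrn_eq0 => /eqP.
Qed.

Lemma chain_rows_injective (m : nat) (f : bitv m -> bitv m -> bool) (y : bitv m -> rat) :
  (forall i, chain_row i (f i)) -> (forall i, \sum_x y x * (f i x)%:R = 0) ->
  y =1 (fun=> 0).
Proof.
move=> fP S0; apply: walsh_transform_eq0.
have X0 := chain_transform0 fP (S0 _).
move=> i; have [n] := ubnP (bitv_rank i); elim: n i => // n IHn i /ltnSE ri.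
have := chain_row_pairing y (fP i); rewrite S0 X0 mulr0 subr0; case: ifP => [_|_ <-//].
move=> [p [c [[_ pi _] _ +]]]; rewrite IHn ?(leq_trans pi)// mulr0 add0r big1 ?addr0 => [<-//|j /andP[ji _]].
by rewrite IHn ?mulr0// (leq_trans ji).
Qed.

(* Since the transform at least doubles along the chain, the sum of all
   earlier terms is dominated by the last one. *)
Lemma chain_growth (m : nat) (f : bitv m -> bitv m -> bool) (y : bitv m -> rat)
    (X := walsh_transform y) :
  (forall i, chain_row i (f i)) ->
  (forall i, \sum_x y x * (f i x)%:R = (heavy i && ~~ chained i)%:R) ->
  forall i, heavy i ->
    \sum_(j : bitv m | heavy j && (bitv_rank j < bitv_rank i)%N) `|X j| <= `|X i| /\
    \prod_(j : bitv m | chained j && (bitv_rank j <= bitv_rank i)%N)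
      (2 ^+ (popcount j).-1 - 2) <= `|X i|.
Proof.
move=> fP SE.
have X0 : X [ffun=> false] = 0.
  by apply: (chain_transform0 fP); rewrite SE /heavy popcount0.
(* The right-hand side is supported on the start of the chain, and light rows are plain
   characters. *)
have Xlight (j : bitv m) : ~~ heavy j -> X j = 0.
  move=> hj; have := chain_row_pairing y (fP j).
  by rewrite light_not_chained// SE (negPf hj) mulr0 -/X X0 subrr => <-.
move=> i; have [n] := ubnP (bitv_rank i); elim: n i => // n IHn i /ltnSE ri hi.
have := chain_row_pairing y (fP i); rewrite SE hi -/X X0 subr0.
case: (boolP (chained i)) => [ci|nci] /=; last first.
  have none (j : bitv m) : heavy j -> (bitv_rank j < bitv_rank i)%N = false.
    move=> hj; apply: contraNF nci => ji; rewrite /chained hi.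
    by apply/existsP; exists j; rewrite hj.
  rewrite mulr1 => <-; split.
    by rewrite big1// => j /andP[hj]; rewrite none.
  rewrite big_pred0// => j; apply/negP => /andP[/andP[_ /existsP[k /andP[hk kj]]] ji].
  by have := none k hk; rewrite (leq_trans kj ji).
move=> [p [c [[hp pi pmax] c1 /esym]]]; rewrite !mulr0 => eqX.
have [sum_p prod_p] := IHn p (leq_trans pi ri) hp.
set w : rat := 2 ^+ (popcount i).-1 in eqX *.
(* Weight at least 3 makes the growth factor [w - 2] at least 2, which is the doubling. *)
have w4 : 4 <= w.
  rewrite /w -[4%R](_ : 2 ^+ 2 = 4)//; apply: ler_weXn2l; first by [].
  by move: hi; rewrite /heavy; case: (popcount i).
have below_p (j : bitv m) : j != p -> heavy j && (bitv_rank j < bitv_rank i)%N =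
    heavy j && (bitv_rank j < bitv_rank p)%N.
  move=> jp; case: (boolP (heavy j)) => //= hj; apply/idP/idP => [ji|jlp].
    rewrite ltn_neqAle pmax// andbT; by apply: contra jp => /eqP /bitv_rank_inj ->.
  exact: ltn_trans pi.
(* Apart from [p], the heavy vectors below [i] are exactly those below [p], so the induction
   hypothesis at [p] bounds their sum. *)
have sum_others : `|\sum_(j : bitv m | (bitv_rank j < bitv_rank i)%N && (j != p)) c j * X j| <= `|X p|.
  apply: le_trans (ler_norm_sum _ _ _) _; apply: le_trans sum_p.
  rewrite [leRHS]big_mkcond [leLHS]big_mkcond /=; apply: ler_sum => j _.
  case: (eqVneq j p) => [_|jp]; first by rewrite andbF; case: ifP.
  rewrite -below_p// andbT; case: (boolP (heavy j)) => [hj|/Xlight ->] /=.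
    by case: ifP => // _; rewrite normrM ler_piMl.
  by rewrite mulr0 normr0 if_same.
have Xi : (w - 2) * `|X p| <= `|X i|.
  set s := \sum_(j | _) _ in eqX sum_others.
  have -> : X i = - ((w - 1) * X p + s) by rewrite -[RHS]addr0 -eqX; ring.
  rewrite normrN; have := lerB_dist ((w - 1) * X p) (- s).
  rewrite opprK normrN normrM ger0_norm; last by lra.
  apply: le_trans; have -> : (w - 2) * `|X p| = (w - 1) * `|X p| - `|X p| by ring.
  lra.
have Xp0 : 0 <= `|X p| by [].
split.
  apply: le_trans Xi; rewrite (bigD1 p) ?hp//=.
  apply: (@le_trans _ _ (2 * `|X p|)); last by rewrite ler_wpM2r//; lra.
  rewrite mulr2n mulrDl mul1r lerD2l; apply: le_trans sum_p.
  rewrite [leRHS]big_mkcond [leLHS]big_mkcond /=; apply: ler_sum => j _.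
  case: (eqVneq j p) => [_|jp]; first by rewrite andbF; case: ifP.
  by rewrite below_p// andbT.
rewrite (bigD1 i) ?ci ?leqnn//= -/w; apply: le_trans Xi.
rewrite ler_wpM2l//; first by lra.
apply: le_trans prod_p; rewrite le_eqVlt; apply/orP; left; apply/eqP.
apply: eq_bigl => j; case: (boolP (chained j)) => //= cj.
have hj : heavy j by case/andP: cj.
apply/andP/idP => [[ji jni]|jlp].
  apply: pmax => //; rewrite ltn_neqAle ji andbT.
  by apply: contra jni => /eqP /bitv_rank_inj ->.
split; first exact: leq_trans jlp (ltnW pi).
by apply: contraTneq jlp => ->; rewrite -ltnNge.
Qed.

(** * The matrix of order [2 ^ m] and a large entry of its inverse *)

Lemma unitmx_injective (F : fieldType) (n : nat) (A : 'M[F]_n) :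
  (forall v : 'cV_n, A *m v = 0 -> v = 0) -> A \in unitmx.
Proof.
move=> injA; rewrite -unitmx_tr -row_free_unit -kermx_eq0.
apply/eqP/row_matrixP => i; rewrite row0; apply: trmx_inj; rewrite trmx0.
by apply: injA; apply: trmx_inj; rewrite trmx_mul trmxK -row_mul mulmx_ker row0 trmx0.
Qed.

Lemma card_bitv (m : nat) : #|{: bitv m}| = (2 ^ m)%N.
Proof. by rewrite card_ffun card_bool card_ord. Qed.

Lemma sum_enum_val (T : finType) (F : T -> rat) :
  \sum_(k < #|T|) F (enum_val k) = \sum_x F x.
Proof. by rewrite -big_enum_val; apply: eq_bigl. Qed.

Lemma chi_pow2_ge_prod (m : nat) : (2 < m)%N ->
  \prod_(j : bitv m | chained j) (2 ^+ (popcount j).-1 - 2) <= 2 ^+ m * chi (2 ^ m).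
Proof.
move=> m3; pose top : bitv m := [ffun=> true].
have htop : heavy top.
  rewrite /heavy /popcount (eq_bigr (fun=> 1%N)) => [|t _]; last by rewrite ffunE.
  by rewrite sum1_card card_ord.
have [f fP] := fin_all_exists (@chain_row_exists m).
pose B : 'M[bool]_#|{: bitv m}| := \matrix_(k, l) f (enum_val k) (enum_val l).
have pairE (v : 'cV[rat]_#|{: bitv m}|) (i : bitv m) :
    (mx01 B *m v) (enum_rank i) 0 = \sum_x v (enum_rank x) 0 * (f i x)%:R.
  rewrite mxE -[RHS]sum_enum_val; apply: eq_bigr => k _.
  by rewrite !mxE enum_rankK enum_valK mulrC.
have uB : mx01 B \in unitmx.
  apply: unitmx_injective => v Bv0; apply/colP => k; rewrite [RHS]mxE -[k]enum_valK.
  apply: (chain_rows_injective (y := fun x => v (enum_rank x) 0) fP) => i.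
  by rewrite -pairE Bv0 mxE.
(* With [i0] the start of the chain, the right-hand side required by [chain_growth] is a unit
   vector, so [y] is a column of the inverse. *)
have [i0 hi0 i0min] := @arg_minnP _ top (@heavy m) (@bitv_rank m) htop.
have i0E i : (i == i0) = heavy i && ~~ chained i.
  apply/eqP/andP => [->|[hi]].
    split=> //; rewrite negb_and negb_exists; apply/orP; right.
    apply/forallP => j; rewrite negb_and -leqNgt -implybE; apply/implyP; exact: i0min.
  rewrite negb_and hi /= => /existsPn /(_ i0); rewrite hi0 /= -leqNgt => ii0.
  by apply: bitv_rank_inj; apply/eqP; rewrite eqn_leq ii0 i0min.
pose y x := invmx (mx01 B) (enum_rank x) (enum_rank i0).
have SE i : \sum_x y x * (f i x)%:R = (heavy i && ~~ chained i)%:R.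
  transitivity ((mx01 B *m col (enum_rank i0) (invmx (mx01 B))) (enum_rank i) 0).
    by rewrite pairE; apply: eq_bigr => x _; rewrite mxE.
  by rewrite colE mulmxA mulmxV// mul1mx !mxE -i0E (inj_eq enum_rank_inj) eqxx andbT.
(* The vector [top] ends the chain, so its bound collects all factors; its transform is a signed sum
   of [2 ^ m] entries of the inverse. *)
have [_] := chain_growth fP SE htop.
have -> : \prod_(j : bitv m | chained j && (bitv_rank j <= bitv_rank top)%N)
    (2 ^+ (popcount j).-1 - 2) =
    \prod_(j : bitv m | chained j) (2 ^+ (popcount j).-1 - 2) :> rat.
  apply: eq_bigl => j; rewrite andb_idr// => _; apply: leq_sum => t _.
  by rewrite ffunE; case: (j t).
move=> /le_trans; apply; apply: le_trans (ler_norm_sum _ _ _) _.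
apply: (@le_trans _ _ (\sum_(x : bitv m) chi (2 ^ m))).
  apply: ler_sum => x _; rewrite normrM norm_walsh mulr1 -card_bitv.
  exact: chi_ge.
by rewrite sumr_const card_bitv -natrX mulr_natl.
Qed.

(** * Asymptotics *)

(** Deleting one bit from a vector of weight above 3 leaves a smaller heavy vector. *)
Lemma popcount_not_chained (m : nat) (i : bitv m) : ~~ chained i -> (popcount i <= 3)%N.
Proof.
apply: contraNT; rewrite -ltnNge => i3.
have /existsP[t it] : [exists t, i t].
  apply: contraTT i3 => /existsPn i0.
  by rewrite /popcount big1// => t _; apply/eqP; rewrite eqb0 i0.
pose j : bitv m := [ffun s => i s && (s != t)].
have popj : popcount i = (popcount j).+1.
  rewrite /popcount (bigD1 t)//= [in RHS](bigD1 t)//= it ffunE eqxx andbF add1n add0n.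
  by congr S; apply: eq_bigr => s st; rewrite ffunE st andbT.
rewrite /chained /heavy (ltnW i3); apply/existsP; exists j.
rewrite -ltnS -popj i3 /=; apply: (bitv_rank_lt (t := t)) => // [s _|].
  by rewrite ffunE; apply/implyP => /andP[].
by rewrite ffunE eqxx andbF.
Qed.

(** Each vector is paired with its complement; their weights add up to [m]. *)
Lemma sum_popcount (m : nat) : (2 * \sum_(a : bitv m) popcount a = m * 2 ^ m)%N.
Proof.
pose neg (a : bitv m) : bitv m := [ffun t => ~~ a t].
have negK : involutive neg by move=> a; apply/ffunP => t; rewrite !ffunE negbK.
rewrite mul2n -addnn {2}(reindex_inj (inv_inj negK)) -big_split /=.
rewrite (eq_bigr (fun=> m)) => [|a _]; first by rewrite sum_nat_const card_bitv mulnC.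
rewrite /popcount -big_split /= (eq_bigr (fun=> 1%N)) => [|t _].
  by rewrite sum1_card card_ord.
by rewrite ffunE; case: (a t).
Qed.

Lemma sum_half_popcount (F : numFieldType) (m : nat) :
  \sum_(a : bitv m) (2 ^+ popcount a)^-1 = (3 / 2) ^+ m :> F.
Proof.
transitivity (\sum_(a : bitv m) \prod_t (2 ^+ a t)^-1 : F).
  by apply: eq_bigr => a _; rewrite prodfV expr_sum.
rewrite -(bigA_distr_bigA (fun (t : 'I_m) b => (2 ^+ (b : bool))^-1 : F)) /=.
rewrite (eq_bigr (fun=> 3 / 2)) => [|t _]; first by rewrite prodr_const card_ord.
by rewrite big_bool /=; field.
Qed.

Lemma ln2_gt0 (R : realType) : 0 < ln 2 :> R.
Proof. by rewrite ln_gt0// ltr1n. Qed.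

Lemma ln2_le1 (R : realType) : ln 2 <= 1 :> R.
Proof. by have := @le_ln1Dx R 1; rewrite -natr1 addrC; apply; lra. Qed.

Lemma expR_ln2 (R : realType) (k : nat) : expR (k%:R * ln 2) = 2 ^+ k :> R.
Proof. by rewrite expRM_natl lnK// posrE. Qed.

Lemma ln_pow2 (R : realType) (k : nat) : ln (2 ^+ k) = k%:R * ln 2 :> R.
Proof. by rewrite -expR_ln2 expRK. Qed.

(* [24] is the least constant for which the factor 1 at weight 3 is covered by
   the estimate [1 + z <= expR z]. *)
Lemma chain_factor_ge (R : realType) (m : nat) (j : bitv m) :
  expR ((popcount j)%:R * ln 2 - ln 2 - 24 / 2 ^+ popcount j)
  <= (if chained j then 2 ^+ (popcount j).-1 - 2 else 1) :> R.
Proof.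
set k := popcount j; set u : R := 2 ^+ k.
have u0 : 0 < u by rewrite exprn_gt0.
rewrite !expRD expR_ln2 -/u !expRN lnK ?posrE//.
have e0 : 0 < 1 + 24 / u by rewrite ltr_pwDl// divr_ge0// ltW.
apply: (@le_trans _ _ (u / 2 / (1 + 24 / u))).
  apply: ler_wpM2l; first by rewrite divr_ge0// ltW.
  by rewrite lef_pV2 ?posrE ?expR_gt0// expR_ge1Dx.
(* A chained [j] has [u >= 8], which makes [10 - 48 / u] nonnegative; otherwise [u <= 8], and
   [u / 2 <= 1 + 24 / u] is an equality at 8. *)
rewrite ler_pdivrMr//; case: ifP => [/andP[hj _]|/negbT /popcount_not_chained hj].
  have -> : 2 ^+ k.-1 = u / 2 :> R.
    by rewrite /u -[in RHS](ltn_predK (hj : 2 < k)%N) exprS mulrAC mulfV ?mul1r.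
  have u8 : 8 <= u.
    rewrite /u -[8%R](_ : 2 ^+ 3 = 8); last by ring.
    by apply: ler_weXn2l => //; rewrite ler1n.
  have -> : (u / 2 - 2) * (1 + 24 / u) = u / 2 + (10 - 48 / u).
    by field; rewrite gt_eqF.
  by rewrite lerDl subr_ge0 ler_pdivrMr//; lra.
rewrite mul1r -(ler_pM2r u0) mulrDl mul1r divfK ?gt_eqF//.
have : u <= 8.
  rewrite /u -[8%R](_ : 2 ^+ 3 = 8); last by ring.
  by apply: ler_weXn2l => //; rewrite ler1n.
by move: u0; nra.
Qed.

Lemma prod_chain_ge (R : realType) (m : nat) :
  expR (ln 2 * (m%:R * 2 ^+ m / 2 - 2 ^+ m) - 24 * (3 / 2) ^+ m)
  <= ratr (\prod_(j : bitv m | chained j) (2 ^+ (popcount j).-1 - 2)) :> R.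
Proof.
have -> : ln 2 * (m%:R * 2 ^+ m / 2 - 2 ^+ m) - 24 * (3 / 2) ^+ m
    = \sum_(j : bitv m) ((popcount j)%:R * ln 2 - ln 2 - 24 / 2 ^+ popcount j) :> R.
  rewrite !sumrB -mulr_suml -mulr_sumr sum_half_popcount sumr_const card_bitv.
  have /(congr1 (fun n => n%:R : R)) := sum_popcount m.
  rewrite !natrM natrX natr_sum => <-.
  by rewrite -[ln 2 *+ _]mulr_natl natrX; field.
rewrite expR_sum rmorph_prod [leRHS]big_mkcond /=; apply: ler_prod => j _.
rewrite expR_ge0 /=; apply: le_trans (chain_factor_ge R j) _.
by case: ifP => // _; rewrite rmorphB rmorphXn /= !ratr_nat.
Qed.

(** Dividing by [2 ^ m] costs [m * ln 2] in the exponent, at most [2 * (3 / 2) ^ m] by Bernoulli's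
    inequality; this raises 24 to 26. For [m <= 2] the exponent is at most 0 and [chi_ge1]
    suffices. *)
Lemma chi_pow2_ge (R : realType) (m : nat) :
  expR (ln 2 * (m%:R * 2 ^+ m / 2 - 2 ^+ m) - 26 * (3 / 2) ^+ m)
  <= ratr (chi (2 ^ m)) :> R.
Proof.
have ln20 := ln2_gt0 R; have ln21 := ln2_le1 R.
have [m3|m2] := ltnP 2 m; last first.
  apply: (@le_trans _ _ 1); last first.
    by rewrite -[leLHS](ratr_nat R 1) ler_rat chi_ge1// expn_gt0.
  rewrite -[leRHS]expR0 ler_expR.
  have : 0 <= (3 / 2 : R) ^+ m by rewrite exprn_ge0.
  have -> : m%:R * 2 ^+ m / 2 - 2 ^+ m = 2 ^+ m * (m%:R - 2) / 2 :> R by field.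
  have : 2 ^+ m * (m%:R - 2) <= 0 :> R.
    by rewrite mulr_ge0_le0 ?exprn_ge0// subr_le0 ler_nat.
  nra.
have /(le_trans (prod_chain_ge R m)) : ratr (\prod_(j : bitv m | chained j)
    (2 ^+ (popcount j).-1 - 2)) <= ratr (2 ^+ m * chi (2 ^ m)) :> R.
  by rewrite ler_rat chi_pow2_ge_prod.
rewrite rmorphM rmorphXn /= ratr_nat => H.
rewrite -(@ler_pM2l _ (2 ^+ m)) ?exprn_gt0//; apply: le_trans H.
rewrite -[X in X * expR _]expR_ln2 -expRD ler_expR.
have : 1 + m%:R / 2 <= (3 / 2 : R) ^+ m.
  elim: m {m3} => [|m IH]; first by rewrite mul0r addr0 expr0.
  rewrite exprS -natr1; have : 0 <= m%:R :> R by []. by nra.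
have : 0 <= m%:R :> R by []. by nra.
Qed.

(** * From powers of two to arbitrary order *)

Lemma xlnx_midpoint (R : realType) (x y : R) : 0 < x -> 0 < y ->
  (x + y) * ln (x + y) - (x + y) * ln 2 <= x * ln x + y * ln y.
Proof.
move=> x0 y0.
(* This is the tangent bound [ln q <= q - 1] at [q = (x + y) / 2 / z]; the right-hand sides for
   [z = x] and [z = y] cancel. *)
have H (z : R) : 0 < z -> z * (ln (x + y) - ln 2 - ln z) <= (x + y) / 2 - z.
  move=> z0; have xy0 : 0 < (x + y) / 2 / z by rewrite !divr_gt0// addr_gt0.
  rewrite -!ln_div ?posrE ?divr_gt0 ?addr_gt0//.
  have : ln ((x + y) / 2 / z) <= (x + y) / 2 / z - 1.
    by rewrite -[X in ln X](subrKC 1) le_ln1Dx// ltrBrDl subrr.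
  by rewrite -(ler_pM2l z0) mulrBr mulr1 [X in _ <= X - _]mulrC divfK ?gt_eqF.
have := H x x0; have := H y y0; nra.
Qed.

(** The largest power of two is split off. The constant 78 solves [26 + 78 * (2 / 3) = 78], since
    the remainder [r] has a smaller binary logarithm. *)
Lemma chi_lower (R : realType) (n : nat) : (0 < n)%N ->
  expR (n%:R / 2 * ln n%:R - 2 * n%:R * ln 2 - 78 * (3 / 2) ^+ trunc_log 2 n)
  <= ratr (chi n) :> R.
Proof.
have ln20 := ln2_gt0 R.
have [N] := ubnP n; elim: N n => // N IHN n /ltnSE nN n0.
set k := trunc_log 2 n.
have /andP[kn nk] := trunc_log_bounds (isT : 1 < 2)%N n0; rewrite -/k in kn nk.
have pow_gt0 : 0 < (3 / 2 : R) ^+ k by rewrite exprn_gt0.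
have p2 : 0 < 2 ^+ k :> R by rewrite exprn_gt0.
have [nE|r0] : n = (2 ^ k)%N \/ (0 < n - 2 ^ k)%N.
  by have := kn; rewrite leq_eqVlt subn_gt0 => /orP[/eqP ->|]; [left|right].
  apply: (@le_trans _ _ (ratr (chi (2 ^ k)))); last by rewrite -nE.
  apply: le_trans (chi_pow2_ge R k); rewrite ler_expR nE natrX ln_pow2.
  nra.
set r := (n - 2 ^ k)%N in r0; have nE : n = (2 ^ k + r)%N by rewrite subnKC.
have rk : (r < 2 ^ k)%N by move: nk; rewrite expnS mul2n -addnn nE ltn_add2l.
have rn : (r < N)%N.
  by apply: leq_trans nN; rewrite nE -add1n leq_add2r expn_gt0.
have lr : (trunc_log 2 r < k)%N.
  by rewrite -(ltn_exp2l _ _ (isT : 1 < 2)%N) (leq_ltn_trans (trunc_logP _ r0)).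
apply: (@le_trans _ _ (ratr (chi (2 ^ k)) * ratr (chi r))); last first.
  by rewrite -rmorphM /= ler_rat [in leRHS]nE chi_mul_le// expn_gt0.
apply: le_trans (ler_pM (expR_ge0 _) (expR_ge0 _) (chi_pow2_ge R k) (IHN r rn r0)).
rewrite -expRD ler_expR.
have powr : (3 / 2 : R) ^+ trunc_log 2 r * (3 / 2) <= (3 / 2) ^+ k.
  by rewrite -exprSr ler_weXn2l//; lra.
have r0' : 0 < r%:R :> R by rewrite ltr0n.
have rk' : r%:R < 2 ^+ k :> R by rewrite -natrX ltr_nat.
(* Half of this convexity loss is [n / 2 * ln 2]. It is covered because the block of order [2 ^ k]
   loses only [2 ^ k * ln 2] of the allowed [2 * 2 ^ k * ln 2], and [r < 2 ^ k]. *)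
have := xlnx_midpoint p2 r0'.
have -> : n%:R = 2 ^+ k + r%:R :> R by rewrite nE natrD natrX.
rewrite (ln_pow2 R k).
move: (ln (2 ^+ k + r%:R)) (ln r%:R) (ln 2) ln20 p2 r0' rk' powr pow_gt0 => A B C.
move: (2 ^+ k) (r%:R) ((3 / 2) ^+ k) ((3 / 2) ^+ trunc_log 2 r) (k%:R) => a s P Q K.
nra.
Qed.

Lemma rho_le (R : realType) (m : nat) :
  ratr (rho m) <= (m.+1%:R : R) `^ (m.+1%:R / 2) / 2 ^+ m.
Proof.
rewrite ler_pdivlMr ?exprn_gt0// mulrC.
have rho0 : 0 <= 2 ^+ m * ratr (rho m) :> R.
  by rewrite mulr_ge0 ?exprn_ge0// ler0q rho_ge0.
rewrite -ler_sqr ?nnegrE ?powR_ge0//.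
have -> : ((m.+1%:R : R) `^ (m.+1%:R / 2)) ^+ 2 = m.+1%:R ^+ m.+1.
  rewrite expr2 -powRD; last by rewrite pnatr_eq0 implybT.
  by rewrite -splitr powR_mulrn.
by have := rho_sqr_le m; rewrite -(ler_rat R) !rmorphXn rmorphM rmorphXn /= !ratr_nat.
Qed.

(** With [k] the binary logarithm, [2 ^ k <= n] bounds the quotient by [(3 / 4) ^ k], and [k] tends
    to infinity. *)
Lemma pow_trunc_log_littleo (R : realType) :
  (fun n => (3 / 2) ^+ trunc_log 2 n / n%:R) @ \oo --> (0 : R).
Proof.
apply: (@squeeze_cvgr _ _ _ _ (fun=> 0) (fun n => (3 / 4) ^+ trunc_log 2 n)).
- exists 1%N => // n /= n0; rewrite divr_ge0 ?exprn_ge0//=.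
  rewrite ler_pdivrMr ?ltr0n//.
  apply: (@le_trans _ _ ((3 / 4) ^+ trunc_log 2 n * 2 ^+ trunc_log 2 n)).
    by rewrite -exprMn (_ : 3 / 4 * 2 = 3 / 2 :> R)//; field.
  by rewrite ler_wpM2l ?exprn_ge0// -natrX ler_nat trunc_logP.
- exact: cvg_cst.
apply: (@cvg_comp _ _ _ (trunc_log 2) (fun k => (3 / 4 : R) ^+ k) _ \oo).
  by apply/cvgnyPge => k; exists (2 ^ k)%N => // n /= kn; exact: trunc_log_max.
by apply: cvg_expr; rewrite ger0_norm; lra.
Qed.

Unset Implicit Arguments.

Theorem mainTheorem16 (R : realType) :
  exists g : nat -> R,
    (fun n : nat => g n / n%:R) @ \oo --> (0 : R) /\
    forall n : nat, (2 <= n)%N ->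
      (n%:R : R) `^ (n%:R / 2) / (2 : R) `^ (2 * n%:R + g n) <= ratr (chi n)
      /\ chi n <= rho n.-1
      /\ (ratr (rho n.-1) : R) <= (n%:R : R) `^ (n%:R / 2) / (2 : R) ^+ n.-1.
Proof.
have ln20 := ln2_gt0 R.
(* The error term of [chi_lower], divided by [ln 2] to become an exponent of 2. *)
exists (fun n => 78 * (3 / 2) ^+ trunc_log 2 n / ln 2); split.
  rewrite (_ : (fun _ => _) = fun n : nat =>
    78 / ln 2 * ((3 / 2) ^+ trunc_log 2 n / n%:R)); last first.
    by apply/funext => n; rewrite mulrACA !mulrA mulrAC.
  rewrite -[X in _ --> X](mulr0 (78 / ln 2)).
  by apply: cvgM; [exact: cvg_cst|exact: pow_trunc_log_littleo].
case=> [//|[//|m]] _; split; last first.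
  by split; [exact: chi_le_rho|exact: rho_le].
apply: le_trans (chi_lower R (ltn0Sn m.+1)).
rewrite /powR !pnatr_eq0 /= -expRN -expRD ler_expR.
rewrite [(_ + _ / ln 2) * _]mulrDl divfK ?gt_eqF//.
by rewrite opprD addrA.
Qed.
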